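(* Let $d\ge1$, $p\in(0,1)$, $S\sim\mathrm{Ber}(p)$, let $X\in\mathbb R^d$ be jointly distributed with $S$, let $\sigma>0$, and let $X^\sigma=X+\sigma Z$ with $Z\sim\mathcal N(0,I)$ independent of $(X,S)$. Let $\mathcal H=\{x\mapsto s(a^{\mathrm T}x+b): a\in\mathbb R^d, b\in\mathbb R\}$. Suppose that either (i) $X=aS+b$ for some $a,b\in\mathbb R^d$, or (ii) for $k\in\{0,1\}$, $(X\vert S=k)\sim\mathcal N(\mu_k,\Sigma)$ for means $\mu_0,\mu_1\in\mathbb R^d$ and a common positive definite covariance matrix $\Sigma\in\mathbb R^{d\times d}$. Then $\epsilon_A=0$.
   Context: $s(z)=1/(1+e^{-z})$ is the sigmoid function. $\eta^\sigma(x)=\mathbb E[S\vert X^\sigma=x]$. $h^*_{\mathcal H}\in\arg\min_{h\in\mathcal H}\mathbb E[(S-h(X^\sigma))^2]$ is a minimizer over $\mathcal H$, and $\epsilon_A:=\mathbb E[(\eta^\sigma(X^\sigma)-h^*_{\mathcal H}(X^\sigma))^2]$. *)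

(* Defs.v *)
From HB Require Import structures.
From mathcomp Require Import all_boot all_order all_algebra.
From mathcomp Require Import all_classical all_reals all_analysis.

Set Implicit Arguments.
Unset Strict Implicit.
Unset Printing Implicit Defensive.

Import Order.TTheory GRing.Theory Num.Theory.
Import numFieldNormedType.Exports.

Local Open Scope classical_set_scope.
Local Open Scope ring_scope.

(* The Borel sigma-algebra of R^n, generated by the coordinate maps, as the
   library does for n.-tuple T. *)
Section measurable_cV.
Context {disp : measure_display} {T : measurableType disp}.
Variable n : nat.

Let coord : 'I_n -> 'cV[T]_n -> T := fun i x => x i ord0.

Let cV_set0 : g_sigma_preimage coord set0.
Proof. exact: sigma_algebra0. Qed.

Let cV_setC A : g_sigma_preimage coord A -> g_sigma_preimage coord (~` A).
Proof. exact: sigma_algebraC. Qed.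

Let cV_bigcup (F : (set 'cV[T]_n)^nat) :
  (forall i, g_sigma_preimage coord (F i)) ->
  g_sigma_preimage coord (\bigcup_i (F i)).
Proof. exact: sigma_algebra_bigcup. Qed.

HB.instance Definition _ := @isMeasurable.Build (measure_tuple_display disp)
  'cV[T]_n (g_sigma_preimage coord) cV_set0 cV_setC cV_bigcup.

End measurable_cV.

Definition cons_cV {T : Type} {n : nat} (z : T * 'cV[T]_n) : 'cV[T]_n.+1 :=
  \col_i if unlift ord0 i is Some j then z.2 j ord0 else z.1.

Section cons_cV_measurable.
Context {disp : measure_display} {T : measurableType disp}.

Lemma measurable_coord_cV n (i : 'I_n) :
  measurable_fun [set: 'cV[T]_n] (fun x : 'cV[T]_n => x i ord0).
Proof.
move=> _ Y mY; rewrite setTI; apply: sub_sigma_algebra => /=.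
rewrite -bigcup_seq/=; exists i => /=; first by rewrite mem_index_enum.
by exists Y => //; rewrite setTI.
Qed.

Lemma measurable_fun_cV d' (T' : measurableType d') n (f : T' -> 'cV[T]_n) :
  (forall i, measurable_fun [set: T'] (fun x => f x i ord0)) ->
  measurable_fun [set: T'] f.
Proof.
move=> mf _ A mA; rewrite setTI.
have : preimage_set_system setT f measurable `<=` measurable.
  rewrite -[X in X `<=` _](@g_sigma_preimage_comp _ T n _
    (fun i (x : 'cV[T]_n) => x i ord0) _ f).
  apply: smallest_sub; first exact: sigma_algebra_measurable.
  case: n => [|n] in f mf A mA *; first by rewrite big_ord0.
  rewrite -bigcup_mkord_ord; apply: bigcup_sub => i Ii.
  by move=> B [C mC <-]; exact: mf.
by apply; exists A => //; rewrite setTI.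
Qed.

Lemma measurable_cons_cV n :
  measurable_fun [set: T * 'cV[T]_n] (@cons_cV T n).
Proof.
apply: measurable_fun_cV => i.
under eq_fun do rewrite mxE.
case: unliftP => [j _|_]; last exact: measurable_fst.
rewrite (_ : (fun _ => _) = (fun x : 'cV[T]_n => x j ord0) \o snd)//.
by apply: measurableT_comp => //; exact: measurable_coord_cV.
Qed.

End cons_cV_measurable.

Section lebesgue_cons.
Context {R : realType} {n : nat}.
Variable mu : {sigma_finite_measure set 'cV[R]_n -> \bar R}.

Let cons (z : measurableTypeR R * 'cV[R]_n) : 'cV[R]_n.+1 := cons_cV z.

Let measurable_cons : measurable_fun setT cons.
Proof. exact: (@measurable_cons_cV _ (measurableTypeR R)). Qed.

Definition lebesgue_cons : set 'cV[R]_n.+1 -> \bar R :=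
  pushforward (lebesgue_measure \x mu)%E cons.

HB.instance Definition _ := Measure.copy lebesgue_cons
  (measure_function_pushforward__canonical__measure_function_Measure
     (lebesgue_measure \x mu)%E measurable_cons).

Let lebesgue_cons_sigma_finite : sigma_finite setT lebesgue_cons.
Proof.
have /sigma_finiteP[F [FT ndF mF]] := sigma_finiteT (@lebesgue_measure R).
have /sigma_finiteP[G [GT ndG mG]] := sigma_finiteT mu.
pose uncons (x : 'cV[R]_n.+1) : measurableTypeR R * 'cV[R]_n :=
  (x ord0 ord0, \col_i x (lift ord0 i) ord0).
have consK : cancel cons uncons.
  case=> t x; rewrite /cons /cons_cV /uncons mxE unlift_none; congr (_, _).
  by apply/colP => i; rewrite !mxE liftK.
have unconsK : cancel uncons cons.
  move=> x; apply/colP => i; rewrite mxE.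
  by case: unliftP => [j|] ->//=; rewrite mxE.
have muncons : measurable_fun setT uncons.
  apply: measurable_fun_pair; first exact: measurable_coord_cV.
  apply: measurable_fun_cV => i.
  by under eq_fun do rewrite mxE; exact: measurable_coord_cV.
exists (fun k => uncons @^-1` (F k `*` G k)).
  apply/seteqP; split=> // x _.
  have [i _ Fi] : (\bigcup_k F k) (uncons x).1 by rewrite -FT.
  have [j _ Gj] : (\bigcup_k G k) (uncons x).2 by rewrite -GT.
  exists (maxn i j) => //; split.
  - by move: Fi; exact/subsetPset/ndF/leq_maxl.
  - by move: Gj; exact/subsetPset/ndG/leq_maxr.
move=> k; have [mFk Fkoo] := mF k; have [mGk Gkoo] := mG k; split.
  by rewrite -[X in measurable X]setTI; apply: muncons => //; exact: measurableX.
rewrite /lebesgue_cons /pushforward -comp_preimage.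
rewrite (_ : uncons \o cons = id); last exact/funext.
by rewrite preimage_id product_measure1E// lte_mul_pinfty// ge0_fin_numE.
Qed.

HB.instance Definition _ := Measure_isSigmaFinite.Build _ _ _ lebesgue_cons
  lebesgue_cons_sigma_finite.

End lebesgue_cons.

(* Lebesgue measure on R^d, as a d-fold product measure transported along
   (t, x) |-> cons_cV (t, x); on the one-point space R^0 it is a unit mass. *)
Fixpoint lebesgue_cV (R : realType) (d : nat) :
    {sigma_finite_measure set 'cV[R]_d -> \bar R} :=
  if d is n.+1 then lebesgue_cons (lebesgue_cV R n) else \d_(0 : 'cV[R]_0).

Definition posdefmx {R : realType} {d : nat} (Sigma : 'M[R]_d) : Prop :=
  Sigma^T = Sigma /\
  forall v : 'cV[R]_d, v != 0 -> 0 < (v^T *m Sigma *m v) ord0 ord0.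

Definition mvnormal_pdf {R : realType} {d : nat}
    (mu : 'cV[R]_d) (Sigma : 'M[R]_d) (x : 'cV[R]_d) : R :=
  (Num.sqrt ((2 * pi) ^+ d * \det Sigma))^-1 *
  expR (- (((x - mu)^T *m invmx Sigma *m (x - mu)) ord0 ord0 / 2)).

(* nu is the law N(mu, Sigma); meaningful for Sigma positive definite. *)
Definition is_mvnormal {R : realType} {d : nat} (nu : set 'cV[R]_d -> \bar R)
    (mu : 'cV[R]_d) (Sigma : 'M[R]_d) : Prop :=
  forall A, measurable A ->
    nu A = (\int[lebesgue_cV R d]_(x in A) (mvnormal_pdf mu Sigma x)%:E)%E.

Section probability_notions.
Context {disp d1 d2 : measure_display} {Omega : measurableType disp}
  {T1 : measurableType d1} {T2 : measurableType d2} {R : realType}.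
Variable P : probability Omega R.

Definition independent_rv (X : Omega -> T1) (Y : Omega -> T2) : Prop :=
  forall A B, measurable A -> measurable B ->
    P (X @^-1` A `&` Y @^-1` B) = (P (X @^-1` A) * P (Y @^-1` B))%E.

Definition cond_law (X : Omega -> T1) (E : set Omega) : set T1 -> \bar R :=
  fun A => (P (X @^-1` A `&` E) / P E)%E.

(* eta is a version of x |-> E[Y | X = x]. *)
Definition is_regression (Y : Omega -> R) (X : Omega -> T1) (eta : T1 -> R) :
    Prop :=
  [/\ measurable_fun [set: T1] eta,
      P.-integrable [set: Omega] (fun w => (eta (X w))%:E)
    & forall B, measurable B ->
        (\int[P]_(w in X @^-1` B) (eta (X w))%:E =
         \int[P]_(w in X @^-1` B) (Y w)%:E)%E].

Definition sq_risk (Y : Omega -> R) (X : Omega -> T1) (h : T1 -> R) : \bar R :=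
  ('E_P[fun w => ((Y w - h (X w)) ^+ 2)%R])%E.

Definition is_risk_minimizer (H : set (T1 -> R)) (Y : Omega -> R)
    (X : Omega -> T1) (h : T1 -> R) : Prop :=
  H h /\ forall g, H g -> (sq_risk Y X h <= sq_risk Y X g)%E.

Definition approximation_error (X : Omega -> T1) (eta h : T1 -> R) : \bar R :=
  ('E_P[fun w => ((eta (X w) - h (X w)) ^+ 2)%R])%E.

End probability_notions.

Definition sigmoid {R : realType} (z : R) : R := 1 / (1 + expR (- z)).

Definition logistic_class (R : realType) (d : nat) : set ('cV[R]_d -> R) :=
  [set h | exists (a : 'cV[R]_d) (b : R),
     h = fun x => sigmoid ((a^T *m x) ord0 ord0 + b)].
Arguments logistic_class : clear implicits.

(* Main.v *)
(* Adding Gaussian noise turns the two class-conditional laws of X into laws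
   whose density ratio is exp of an affine function, and no convolution is
   needed to see it.  Pick c with (Sigma + sigma^2 I) c = mu_1 - mu_0 (in the
   deterministic case, sigma^2 c = a, i.e. Sigma = 0).  Translating x by
   Sigma c and z by sigma c multiplies the Gaussian densities by the factors
   exp(c.x + const) and exp(sigma c.z + const), whose product depends only on
   c.(x + sigma z), and together the two translations move the mean of
   x + sigma z by mu_1 - mu_0.  Hence the law of Xsigma on {S = 1} is exp(L)
   times its law on {S = 0} with L affine, so sigmoid(L) is the regression
   function.  It lies in the logistic class, and the squared risk of g is that
   of sigmoid(L) plus E[(g - sigmoid(L))^2], so every minimizer agrees with
   sigmoid(L) almost everywhere for the law of Xsigma. *)
Require Import Defs.
From HB Require Import structures.
From mathcomp Require Import all_boot all_order all_algebra.
From mathcomp Require Import ring lra.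
From mathcomp Require Import all_classical all_reals all_analysis.
From mathcomp Require Import measurable_realfun.

Import Order.TTheory GRing.Theory Num.Theory.
Import numFieldNormedType.Exports.

Local Open Scope classical_set_scope.
Local Open Scope ring_scope.

(** * Integrals against measures with densities and against laws restricted to an event *)

Section density.
Local Open Scope ereal_scope.
Context d (T : measurableType d) (R : realType).
Variables (mu nu : {measure set T -> \bar R}) (g : T -> R).
Hypothesis mg : measurable_fun [set: T] g.
Hypothesis g0 : forall x, (0 <= g x)%R.
Hypothesis nug : forall A, measurable A -> nu A = \int[mu]_(x in A) (g x)%:E.

Import HBNNSimple.

(** Hypothesis [nug] is the case of an indicator; linearity extends it to simple functions, and
    monotone convergence on both sides to every nonnegative measurable [f]. *)
Lemma ge0_integral_density (f : T -> \bar R) :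
  measurable_fun [set: T] f -> (forall x, 0 <= f x) ->
  \int[nu]_x f x = \int[mu]_x (f x * (g x)%:E).
Proof.
move=> mf f0; pose h := nnsfun_approx measurableT mf.
have mge : measurable_fun [set: T] (fun x => (g x)%:E) by exact/measurable_EFinP.
have fE x : (h n x)%:E @[n --> \oo] --> f x.
  by apply: cvg_nnsfun_approx => // *; exact: f0.
have ndh x : nondecreasing_seq (fun n => (h n x)%:E).
  by move=> m n mn; rewrite lee_fin; exact/lefP/nd_nnsfun_approx.
have -> : \int[nu]_x f x = limn (fun n => \int[nu]_x (h n x)%:E).
  rewrite -monotone_convergence//.
  - by apply: eq_integral => x _; apply/esym/cvg_lim => //; exact: fE.
  - by move=> n; exact/measurable_EFinP.
  - by move=> n x _; rewrite lee_fin.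
have -> : \int[mu]_x (f x * (g x)%:E) =
    limn (fun n => \int[mu]_x ((h n x)%:E * (g x)%:E)).
  rewrite -monotone_convergence//.
  - apply: eq_integral => x _; apply/esym/cvg_lim => //.
    by apply: cvgeZr => //; exact: fE.
  - by move=> n; apply: emeasurable_funM => //; exact/measurable_EFinP.
  - by move=> n x _; rewrite mule_ge0// lee_fin.
  - by move=> x _ m n mn; rewrite lee_wpmul2r ?lee_fin//; apply: ndh.
congr (limn _); apply/funext => n.
under eq_integral do rewrite fimfunE -fsumEFin//.
rewrite ge0_integral_fsum//; last 2 first.
- by move=> r; exact/measurable_EFinP/measurable_funM.
- by move=> r x _; rewrite EFinM nnfun_muleindic_ge0.
under [RHS]eq_integral => x _.
  rewrite fimfunE -fsumEFin// ge0_mule_fsuml => [|y]; last first.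
    exact: nnfun_muleindic_ge0.
  over.
rewrite ge0_integral_fsum//; last 2 first.
- move=> r; apply: emeasurable_funM => //.
  exact/measurable_EFinP/measurable_funM.
- by move=> r x _; apply: mule_ge0; [exact: nnfun_muleindic_ge0|rewrite lee_fin].
apply: eq_fsbigr => r _.
(* The sum runs over the range of [h n], which is nonnegative, so a negative [r] has empty preimage
   and contributes 0 on both sides; the other case can factor [r] out of nonnegative integrals. *)
have [r0|r0] := ltP r 0%R.
  have h0 : h n @^-1` [set r] = set0.
    by apply/seteqP; split=> // x /= hx; move: r0; rewrite -hx ltNge fun_ge0.
  by rewrite h0 indic0; under [RHS]eq_integral do rewrite mulr0 mul0e;
     under eq_integral do rewrite mulr0; rewrite !integral0.
have mhr : measurable (h n @^-1` [set r]) by exact: measurable_funPTI.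
under eq_integral do rewrite EFinM.
rewrite ge0_integralZl//; last by apply/measurable_EFinP; exact: measurable_indic.
rewrite integral_indic// setIT nug//.
under [RHS]eq_integral do rewrite EFinM -muleA.
rewrite ge0_integralZl//; last 2 first.
- by apply: emeasurable_funM => //; apply/measurable_EFinP; exact: measurable_indic.
- by move=> x _; rewrite mule_ge0// ?lee_fin.
congr (_ * _); rewrite integral_mkcond; apply: eq_integral => x _.
by rewrite patchE indicE; case: ifPn; rewrite (mul1e, mul0e).
Qed.

End density.

Section restricted_law.
Local Open Scope ereal_scope.
Context d d' (T : measurableType d) (T' : measurableType d') (R : realType).
Variables (P : {measure set T -> \bar R}) (E : set T).
Hypothesis mE : measurable E.

Lemma ge0_integral_mrestr (f : T -> \bar R) :
  measurable_fun [set: T] f -> (forall x, 0 <= f x) ->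
  \int[mrestr P mE]_x f x = \int[P]_(x in E) f x.
Proof.
move=> mf f0; rewrite (@ge0_integral_density _ _ _ P _ \1_E)//.
- rewrite [RHS]integral_mkcond; apply: eq_integral => x _.
  by rewrite patchE indicE; case: ifPn; rewrite (mule1, mule0).
- by move=> A mA; rewrite integral_indic// setIC.
Qed.

(** The image under [X] of [P] restricted to [E] has density [g]. It is left unnormalised, so that
    the class weights enter as factors of [g]. *)
Lemma ge0_integral_law_density (mu : {measure set T' -> \bar R}) (X : T -> T')
    (g : T' -> R) (f : T' -> \bar R) :
  measurable_fun [set: T] X -> measurable_fun [set: T'] g ->
  (forall x, (0 <= g x)%R) ->
  (forall A, measurable A ->
    P (X @^-1` A `&` E) = \int[mu]_(x in A) (g x)%:E) ->
  measurable_fun [set: T'] f -> (forall x, 0 <= f x) ->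
  \int[P]_(w in E) f (X w) = \int[mu]_x (f x * (g x)%:E).
Proof.
move=> mX mg g0 Xg mf f0.
rewrite -(@ge0_integral_density _ _ _ _
  (measure_function_pushforward__canonical__measure_function_Measure
     (mrestr P mE) mX))//.
rewrite [RHS]ge0_integral_pushforward//= preimage_setT ge0_integral_mrestr//.
exact: measurableT_comp.
Qed.

End restricted_law.

(** * Independence as a product law *)

Section independence.
Local Open Scope ereal_scope.
Context d d1 d2 (T : measurableType d) (T1 : measurableType d1)
  (T2 : measurableType d2) (R : realType) (P : probability T R).
Variables (Z : {RV P >-> T1}) (Y : {RV P >-> T2}).

(** Independence gives the joint law the product values on rectangles, hence it is the product
    measure by uniqueness. Tonelli then integrates out [Z] with [Y] held fixed. *)
Lemma ge0_integral_independent (G : T2 * T1 -> \bar R) :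
  independent_rv P Z Y ->
  measurable_fun [set: T2 * T1] G -> (forall u, 0 <= G u) ->
  \int[P]_w G (Y w, Z w) = \int[P]_w \int[distribution P Z]_z G (Y w, z).
Proof.
move=> indep mG G0.
have mYZ : measurable_fun [set: T] (fun w => (Y w, Z w)).
  by apply: measurable_fun_pair.
rewrite -[RHS](@ge0_integral_distribution _ _ _ _ _ _ Y
  (fun y => \int[distribution P Z]_z G (y, z)))//; last 2 first.
- exact: (measurable_fun_fubini_tonelli_F (m2 := distribution P Z)).
- by move=> y; exact: integral_ge0.
rewrite -(@fubini_tonelli1 _ _ _ _ _ (distribution P Y) (distribution P Z))//.
transitivity (\int[pushforward P (fun w => (Y w, Z w))]_u G u).
  by rewrite ge0_integral_pushforward.
apply: eq_measure_integral => A mA _.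
apply/esym/(@product_measure_unique _ _ _ _ _ (distribution P Y)
  (distribution P Z)
  (measure_function_pushforward__canonical__measure_function_Measure P mYZ)) => // B C mB mC.
by rewrite /= muleC -[RHS]indep// setIC.
Qed.

End independence.

(** * Translation invariance of Lebesgue measure on R and on R^n *)

Section lebesgue_translation.
Local Open Scope ereal_scope.
Context {R : realType}.

(** Translating a half-open interval keeps its length, and these lengths determine Lebesgue
    measure. *)
Lemma lebesgue_measure_translate (a : R) (A : set R) : measurable A ->
  pushforward lebesgue_measure (fun x => x + a : measurableTypeR R)%R A =
  lebesgue_measure A.
Proof.
have ma : measurable_fun [set: measurableTypeR R]
    (fun x => x + a : measurableTypeR R)%R.
  by apply: measurable_funD.
move=> mA; apply/esym; apply: (@lebesgue_measure_unique R
  (measure_function_pushforward__canonical__measure_function_Measure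
     lebesgue_measure ma)) => //= _ [[x y]] _ <-.
rewrite /pushforward (_ : _ @^-1` _ = [set` `]x - a, y - a]%R]); last first.
  by apply/seteqP; split=> z /=; rewrite !in_itv/= ltrBlDr lerBrDr.
rewrite !lebesgue_measure_itv/= !lte_fin ltrD2r.
by case: ifPn => // _; rewrite -!EFinB opprB addrA subrK.
Qed.

Lemma ge0_integral_translate (a : R) (f : R -> \bar R) :
  measurable_fun [set: R] f -> (forall x, 0 <= f x) ->
  \int[lebesgue_measure]_x f (x + a)%R = \int[lebesgue_measure]_x f x.
Proof.
move=> mf f0.
have ma : measurable_fun [set: measurableTypeR R]
    (fun x => x + a : measurableTypeR R)%R.
  by apply: measurable_funD.
rewrite -[LHS](@ge0_integral_pushforward _ _ _ _ _ _ ma lebesgue_measure setT f)//.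
by apply: eq_measure_integral => A mA _; exact: lebesgue_measure_translate.
Qed.

(** Induction on the dimension: Tonelli splits off the first coordinate, where the one-dimensional
    case applies, and the remaining coordinates are the induction hypothesis. R^0 is a single
    point. *)
Lemma ge0_integral_translate_cV n (a : 'cV[R]_n) (f : 'cV[R]_n -> \bar R) :
  measurable_fun [set: 'cV[R]_n] f -> (forall x, 0 <= f x) ->
  \int[lebesgue_cV R n]_x f (x + a)%R = \int[lebesgue_cV R n]_x f x.
Proof.
elim: n a f => [|n IHn] a f mf f0.
  by apply: eq_integral => x _; congr f; apply/colP; case.
pose cons (z : measurableTypeR R * 'cV[R]_n) : 'cV[R]_n.+1 := cons_cV z.
have mcons : measurable_fun setT cons.
  exact: (@measurable_cons_cV _ (measurableTypeR R)).
have lebE (g : 'cV[R]_n.+1 -> \bar R) :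
    measurable_fun [set: 'cV[R]_n.+1] g -> (forall x, 0 <= g x) ->
  \int[lebesgue_cV R n.+1]_x g x =
  \int[lebesgue_measure]_t \int[lebesgue_cV R n]_x g (cons_cV (t, x)).
  move=> mg g0.
  transitivity (\int[lebesgue_measure \x lebesgue_cV R n]_u g (cons u)).
    exact: (ge0_integral_pushforward mcons).
  rewrite fubini_tonelli1//.
  exact: measurableT_comp.
have maddr : measurable_fun [set: 'cV[R]_n.+1] (fun x => x + a)%R.
  apply: measurable_fun_cV => i; under eq_fun do rewrite mxE.
  by apply: measurable_funD => //; exact: measurable_coord_cV.
rewrite !lebE//; last exact: measurableT_comp.
pose a' : 'cV[R]_n := (\col_i a (lift ord0 i) ord0)%R.
have consD t x : (cons (t, x) + a = cons (t + a ord0 ord0, x + a'))%R.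
  apply/colP => i; rewrite !mxE; case: unliftP => [j ->|->]//=.
  by rewrite !mxE.
have mfcons : measurable_fun setT (f \o cons) by exact: measurableT_comp.
under eq_integral => t _.
  under eq_integral do rewrite consD.
  rewrite (IHn a' (fun x => f (cons ((t + a ord0 ord0)%R, x))))//; last first.
    exact: (measurableT_comp mfcons (pair1_measurable _)).
  over.
rewrite (ge0_integral_translate _
  (fun t : R => \int[lebesgue_cV R n]_x f (cons (t, x))))//.
- by apply: (measurable_fun_fubini_tonelli_F (m2 := lebesgue_cV R n)
    (f \o cons)) => //= u.
- by move=> t; exact: integral_ge0.
Qed.

End lebesgue_translation.

(** * Inner products, positive definite matrices and translated Gaussian densities *)

Local Notation dot c x := ((c^T *m x) ord0 ord0).

Section gaussian_shift.
Context {R : realType} {d : nat}.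
Implicit Types (c x y mu : 'cV[R]_d) (Sigma : 'M[R]_d).

Lemma dotC x y : dot x y = dot y x.
Proof. by rewrite -[x^T *m y]trmxK trmx_mul trmxK mxE. Qed.

Lemma dotDr c x y : dot c (x + y) = dot c x + dot c y.
Proof. by rewrite mulmxDr mxE. Qed.

Lemma dotZr c k x : dot c (k *: x) = k * dot c x.
Proof. by rewrite -scalemxAr mxE. Qed.

Lemma dotZl c k x : dot (k *: c) x = k * dot c x.
Proof. by rewrite linearZ/= -scalemxAl mxE. Qed.

Lemma measurable_dot c : measurable_fun [set: 'cV[R]_d] (fun x => dot c x).
Proof.
under eq_fun do rewrite mxE.
apply: measurable_sum => i; apply: measurable_funM => //.
exact: measurable_coord_cV.
Qed.

Lemma measurable_cVD d' (T : measurableType d') (f g : T -> 'cV[R]_d) :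
  measurable_fun [set: T] f -> measurable_fun [set: T] g ->
  measurable_fun [set: T] (fun w => f w + g w).
Proof.
move=> mf mg; apply: measurable_fun_cV => i; under eq_fun do rewrite mxE.
by apply: measurable_funD;
  [exact: measurableT_comp (measurable_coord_cV _) mf |
   exact: measurableT_comp (measurable_coord_cV _) mg].
Qed.

Lemma measurable_cVZ d' (T : measurableType d') k (f : T -> 'cV[R]_d) :
  measurable_fun [set: T] f -> measurable_fun [set: T] (fun w => k *: f w).
Proof.
move=> mf; apply: measurable_fun_cV => i; under eq_fun do rewrite mxE.
by apply: measurable_funM => //;
  exact: measurableT_comp (measurable_coord_cV _) mf.
Qed.

Lemma measurable_mvnormal_pdf mu Sigma :
  measurable_fun [set: 'cV[R]_d] (mvnormal_pdf mu Sigma).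
Proof.
apply: measurable_funM => //; apply: measurableT_comp => //.
apply: measurable_funN; apply: measurable_funM => //.
under eq_fun do rewrite mxE.
have mcoord i : measurable_fun [set: 'cV[R]_d] (fun x => (x - mu) i ord0).
  under eq_fun do rewrite mxE.
  by apply: measurable_funD => //; exact: measurable_coord_cV.
apply: measurable_sum => i; apply: measurable_funM => //.
under eq_fun do rewrite mxE.
apply: measurable_sum => j; apply: measurable_funM => //.
by under eq_fun do rewrite mxE; exact: mcoord.
Qed.

Lemma mvnormal_pdf_ge0 mu Sigma x : 0 <= mvnormal_pdf mu Sigma x.
Proof. by rewrite mulr_ge0 ?invr_ge0 ?sqrtr_ge0 ?expR_ge0. Qed.

(** Expanding the quadratic form: with y = x - mu and u = Sigma c, the form at y - u is the form at
    y minus 2 c.y plus c.u. The inverse of Sigma disappears from the correction because the shift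
    lies along Sigma c. *)
Lemma mvnormal_pdf_shift mu Sigma c x :
  Sigma^T = Sigma -> Sigma \in unitmx ->
  mvnormal_pdf mu Sigma (x - Sigma *m c) =
  mvnormal_pdf mu Sigma x * expR (dot c (x - mu) - dot c (Sigma *m c) / 2).
Proof.
move=> Ssym Sunit; rewrite /mvnormal_pdf -mulrA -expRD addrAC.
set y := x - mu; set u := Sigma *m c.
have uA : u^T *m invmx Sigma = c^T by rewrite trmx_mul Ssym mulmxK.
have Au : invmx Sigma *m u = c by rewrite mulKmx.
have -> : (y - u)^T *m invmx Sigma *m (y - u) =
    y^T *m invmx Sigma *m y - c^T *m y - y^T *m c + c^T *m u.
  have -> : (y - u)^T = y^T - u^T by rewrite linearB.
  rewrite mulmxBl uA mulmxBl !mulmxBr -(mulmxA _ _ u) Au.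
  by rewrite opprB addrA addrAC; congr (_ + _); rewrite addrAC.
congr (_ * expR _).
have := dotC y c; move: (y^T *m c) (c^T *m y) (c^T *m u) (_ *m y).
by move=> l l' r q ll'; rewrite !mxE ll'; lra.
Qed.

(** A nonzero row vector in the left kernel would make the quadratic form vanish. *)
Lemma posdefmx_unit Sigma : posdefmx Sigma -> Sigma \in unitmx.
Proof.
move=> [Ssym Spos]; rewrite -row_free_unit -kermx_eq0.
apply/negPn/negP => /rowV0Pn[v /sub_kermxP vS v0].
have := Spos v^T; rewrite trmx_eq0 trmxK => /(_ v0).
by rewrite vS mul0mx mxE ltxx.
Qed.

Lemma posdefmxD_scalar Sigma (s : R) :
  posdefmx Sigma -> 0 <= s -> posdefmx (Sigma + s%:M).
Proof.
move=> [Ssym Spos] s0; split; first by rewrite linearD/= Ssym tr_scalar_mx.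
move=> v v0; rewrite mulmxDr mulmxDl mxE ltr_pwDl ?Spos//.
rewrite mul_mx_scalar -scalemxAl mxE mulr_ge0// mxE sumr_ge0// => i _.
by rewrite mxE -expr2 sqr_ge0.
Qed.

End gaussian_shift.

(** * Effect of independent Gaussian noise on the two classes *)

Section gaussian_noise.
Local Open Scope ereal_scope.
Context {R : realType} {d : nat} {disp : measure_display}
  {Omega : measurableType disp} {P : probability Omega R}.
Variables (S : {RV P >-> bool}) (X Z : {RV P >-> 'cV[R]_d}) (sigma : R).
Hypothesis Z_normal : is_mvnormal (distribution P Z) 0 1%:M.
Hypothesis Z_indep : independent_rv P Z (fun w => (X w, S w)).

Let phi := @mvnormal_pdf R d 0 1%:M.

(** The expectation of F(x + sigma Z), that is, the Gaussian smoothing of [F] at scale sigma. *)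
Let smooth (F : 'cV[R]_d -> \bar R) (x : 'cV[R]_d) : \bar R :=
  \int[lebesgue_cV R d]_z (F (x + sigma *: z)%R * (phi z)%:E).

Lemma measurable_event k : measurable (S @^-1` [set k]).
Proof. by rewrite -[X in measurable X]setTI; exact: measurable_funP. Qed.

Section fixed_integrand.
Variable F : 'cV[R]_d -> \bar R.
Hypotheses (mF : measurable_fun [set: 'cV[R]_d] F) (F0 : forall x, 0 <= F x).

Lemma measurable_noise_shift x :
  measurable_fun [set: 'cV[R]_d] (fun z => F (x + sigma *: z)%R).
Proof.
apply: measurableT_comp => //; apply: measurable_cVD => //.
exact: measurable_cVZ.
Qed.

Lemma integral_noise k :
  \int[P]_(w in S @^-1` [set k]) F (X w + sigma *: Z w)%R =
  \int[P]_(w in S @^-1` [set k]) smooth F (X w).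
Proof.
(* The event S = k becomes an indicator factor, so that the integrand depends on the pair (X, S), of
   which [Z] is independent, and on [Z]. *)
pose G (u : ('cV[R]_d * bool) * 'cV[R]_d) : \bar R :=
  F (u.1.1 + sigma *: u.2)%R * (u.1.2 == k)%:R%:E.
have mG : measurable_fun setT G.
  apply: emeasurable_funM.
    apply: measurableT_comp => //; apply: measurable_cVD.
      exact: measurableT_comp measurable_fst measurable_fst.
    by apply: measurable_cVZ; exact: measurable_snd.
  apply/measurable_EFinP.
  apply: (@measurableT_comp _ _ _ _ _ _ (fun b : bool => (b == k)%:R : R)) => //.
  exact: measurableT_comp measurable_snd measurable_fst.
have G0 u : 0 <= G u by rewrite mule_ge0// lee_fin.
have mXS : measurable_fun [set: Omega] (fun w => (X w, S w)).
  exact: measurable_fun_pair.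
pose XS : {RV P >-> ('cV[R]_d * bool)%type} :=
  HB.pack (fun w => (X w, S w)) (isMeasurableFun.Build _ _ _ _ _ mXS).
have Sk w : (w \in S @^-1` [set k]) = (S w == k).
  by apply/idP/eqP; rewrite inE.
transitivity (\int[P]_w G (XS w, Z w)).
  rewrite [LHS]integral_mkcond; apply: eq_integral => w _ /=.
  by rewrite patchE /G/= Sk; case: eqP; rewrite (mule1, mule0).
rewrite (@ge0_integral_independent _ _ _ _ _ _ _ P Z XS)//.
rewrite [RHS]integral_mkcond; apply: eq_integral => w _ /=.
have mGw : measurable_fun [set: 'cV[R]_d] (fun z => G ((X w, S w), z)).
  exact: measurableT_comp mG (pair1_measurable _).
rewrite (@ge0_integral_density _ _ _ (lebesgue_cV R d) _ phi)//; last 2 first.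
- exact: measurable_mvnormal_pdf.
- exact: mvnormal_pdf_ge0.
rewrite patchE /G/= Sk; case: eqP => _.
  by apply: eq_integral => z _; rewrite mule1.
by under eq_integral do rewrite mule0 mul0e; rewrite integral0.
Qed.

Lemma measurable_smooth : measurable_fun [set: 'cV[R]_d] (smooth F).
Proof.
apply: (measurable_fun_fubini_tonelli_F (m2 := lebesgue_cV R d)
  (fun u : 'cV[R]_d * 'cV[R]_d => F (u.1 + sigma *: u.2)%R * (phi u.2)%:E)) => [|u].
  apply: emeasurable_funM.
    apply: measurableT_comp => //; apply: measurable_cVD; first exact: measurable_fst.
    by apply: measurable_cVZ; exact: measurable_snd.
  apply/measurable_EFinP; apply: measurableT_comp measurable_snd.
  exact: measurable_mvnormal_pdf.
by rewrite mule_ge0// lee_fin mvnormal_pdf_ge0.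
Qed.

Lemma smooth_ge0 x : 0 <= smooth F x.
Proof.
by apply: integral_ge0 => z _; rewrite mule_ge0// lee_fin mvnormal_pdf_ge0.
Qed.

(** Substituting z - sigma c for z cancels the displacement sigma^2 c inside [F] and moves it into
    the noise density, where [mvnormal_pdf_shift] with identity covariance turns it into an
    exponential factor. *)
Lemma smooth_shift (c : 'cV[R]_d) (x : 'cV[R]_d) :
  smooth F (x + (sigma ^+ 2)%R *: c)%R =
  \int[lebesgue_cV R d]_z (F (x + sigma *: z)%R *
     (phi z * expR (sigma * dot c z - sigma ^+ 2 * dot c c / 2))%:E).
Proof.
rewrite /smooth -[LHS](ge0_integral_translate_cV _ (- (sigma *: c))%R); last 2 first.
- apply: emeasurable_funM; first exact: measurable_noise_shift.
  apply/measurable_EFinP; exact: measurable_mvnormal_pdf.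
- by move=> z; rewrite mule_ge0// lee_fin mvnormal_pdf_ge0.
apply: eq_integral => z _; congr (F _ * _%:E).
  by rewrite scalerDr scalerN scalerA expr2 addrACA subrr addr0.
have := @mvnormal_pdf_shift R d 0 1%:M (sigma *: c) z.
rewrite /phi mul1mx trmx1 unitmx1 => -> //.
by rewrite subr0 dotZl dotZl dotZr expr2 !mulrA.
Qed.

End fixed_integrand.

(** The exponent c.x + kappa coming from [X] and the exponent sigma c.z - sigma^2 c.c / 2 coming
    from the noise add up to an affine function of x + sigma z alone. *)
Lemma noise_tilt (c : 'cV[R]_d) (kappa : R) :
  (forall F : 'cV[R]_d -> \bar R, measurable_fun [set: 'cV[R]_d] F ->
     (forall x, 0 <= F x) ->
     \int[P]_(w in S @^-1` [set true]) F (X w) =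
     \int[P]_(w in S @^-1` [set false])
       (F (X w + (sigma ^+ 2)%R *: c)%R * (expR (dot c (X w) + kappa))%:E)) ->
  forall F : 'cV[R]_d -> \bar R, measurable_fun [set: 'cV[R]_d] F ->
     (forall x, 0 <= F x) ->
     \int[P]_(w in S @^-1` [set true]) F (X w + sigma *: Z w)%R =
     \int[P]_(w in S @^-1` [set false])
       (F (X w + sigma *: Z w)%R * (expR (dot c (X w + sigma *: Z w) +
          (kappa - sigma ^+ 2 * dot c c / 2)))%:E).
Proof.
move=> XQ F mF F0.
have mtilt : measurable_fun [set: 'cV[R]_d] (fun x =>
    F x * (expR (dot c x + (kappa - sigma ^+ 2 * dot c c / 2)))%:E).
  apply: emeasurable_funM => //; apply/measurable_EFinP/measurableT_comp => //.
  by apply: measurable_funD => //; exact: measurable_dot.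
have tilt0 x :
    0 <= F x * (expR (dot c x + (kappa - sigma ^+ 2 * dot c c / 2)))%:E.
  by rewrite mule_ge0// lee_fin expR_ge0.
rewrite integral_noise// [RHS](integral_noise _ mtilt tilt0) XQ; last 2 first.
- exact: measurable_smooth.
- exact: smooth_ge0.
apply: eq_integral => w _; rewrite smooth_shift// muleC -ge0_integralZl//.
- apply: eq_integral => z _; rewrite muleCA -!muleA -!EFinM; congr (_ * _%:E).
  rewrite mulrCA -expRD [RHS]mulrC; congr (_ * expR _)%R.
  by rewrite dotDr dotZr; ring.
- apply: emeasurable_funM; first exact: measurable_noise_shift.
  apply/measurable_EFinP; apply: measurable_funM.
    exact: measurable_mvnormal_pdf.
  apply: measurableT_comp => //; apply: measurable_funB => //.
  by apply: measurable_funM => //; exact: measurable_dot.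
- by move=> z _; rewrite mule_ge0// lee_fin mulr_ge0 ?mvnormal_pdf_ge0 ?expR_ge0.
Qed.

End gaussian_noise.

(** * Class weights and the tilt between the class-conditional laws of X in the two cases *)

Lemma bernoulli_prob1 {R : realType} (p : R) (k : bool) :
  0 <= p <= 1 -> bernoulli_prob p [set k] = (bernoulli_pmf p k)%:E.
Proof.
move=> p01; rewrite /bernoulli_prob p01 fsbig_set1//.
Qed.

Section class_conditional_tilt.
Local Open Scope ereal_scope.
Context {R : realType} {d : nat} {disp : measure_display}
  {Omega : measurableType disp} {P : probability Omega R}.
Variables (S : {RV P >-> bool}) (X : {RV P >-> 'cV[R]_d}).
Variables (q : bool -> R) (sigma : R).
Hypotheses (q0 : forall k, (0 < q k)%R)
  (PS : forall k, P (S @^-1` [set k]) = (q k)%:E).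
Hypothesis sigma_gt0 : (0 < sigma)%R.

(* The law of X given S = 1 is, up to an exponential factor, that given S = 0
   shifted by only part of the difference of the means: in the Gaussian case
   sigma^2 c = mu_1 - mu_0 - Sigma c, since completing the square absorbs the
   remaining Sigma c.  [noise_tilt] carries out this shift on the noise Z. *)
Let tilted := exists (c : 'cV[R]_d) (kappa : R),
  forall F : 'cV[R]_d -> \bar R, measurable_fun [set: 'cV[R]_d] F ->
  (forall x, 0 <= F x) ->
  \int[P]_(w in S @^-1` [set true]) F (X w) =
  \int[P]_(w in S @^-1` [set false])
    (F (X w + (sigma ^+ 2)%R *: c)%R * (expR (dot c (X w) + kappa))%:E).

(** On each class [X] is almost surely constant, so both sides are a value of [F] times a weight.
    Taking sigma^2 c = a makes the points agree, and kappa makes the weights agree at the point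
    b. *)
Lemma point_mass_tilt (a b : 'cV[R]_d) :
  {ae P, forall w, X w = ((S w)%:R *: a + b)%R} -> tilted.
Proof.
move=> XS; pose c := ((sigma ^+ 2)^-1 *: a)%R.
have ca : ((sigma ^+ 2) *: c = a)%R.
  by rewrite scalerA divff ?scale1r// expf_eq0/= gt_eqF.
have XE (G : 'cV[R]_d -> \bar R) k : measurable_fun [set: 'cV[R]_d] G ->
    (forall x, 0 <= G x) ->
  \int[P]_(w in S @^-1` [set k]) G (X w) = G (k%:R *: a + b)%R * (q k)%:E.
  move=> mG G0; rewrite -PS -integral_cst; last exact: measurable_event.
  apply: ae_eq_integral => //.
  - exact: measurable_event.
  - by apply: measurable_funTS; exact: measurableT_comp.
  - by move: XS; apply: filterS => w -> /= ->.
exists c, (ln (q true / q false) - dot c b)%R => F mF F0.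
have mtilt : measurable_fun [set: 'cV[R]_d] (fun x =>
    F (x + (sigma ^+ 2)%R *: c)%R *
    (expR (dot c x + (ln (q true / q false) - dot c b)))%:E).
  apply: emeasurable_funM.
    by apply: measurableT_comp => //; apply: measurable_cVD.
  apply/measurable_EFinP/measurableT_comp => //.
  by apply: measurable_funD => //; exact: measurable_dot.
rewrite XE// (XE _ false mtilt); last first.
  by move=> x; rewrite mule_ge0// lee_fin expR_ge0.
rewrite scale0r add0r scale1r ca addrCA subrr addr0 lnK ?posrE ?divr_gt0//.
by rewrite -muleA -EFinM divfK ?gt_eqF// (addrC b).
Qed.

Lemma gaussian_classes_tilt (mu : bool -> 'cV[R]_d) (Sigma : 'M[R]_d) :
  posdefmx Sigma ->
  (forall k, is_mvnormal (cond_law P X (S @^-1` [set k])) (mu k) Sigma) ->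
  tilted.
Proof.
move=> Spos Xnormal.
have Sunit := posdefmx_unit _ Spos; have [Ssym _] := Spos.
have Tunit : (Sigma + (sigma ^+ 2)%:M)%R \in unitmx.
  by apply/posdefmx_unit/posdefmxD_scalar => //; exact: sqr_ge0.
(* The two displacements Sigma c and sigma^2 c must add up to the difference of the means. *)
pose c := (invmx (Sigma + (sigma ^+ 2)%:M) *m (mu true - mu false))%R.
have cE : (Sigma *m c + (sigma ^+ 2) *: c = mu true - mu false)%R.
  by rewrite -mul_scalar_mx -mulmxDl mulKVmx.
(* The weight [q k] undoes the division by the probability of S = k in [cond_law]. *)
have XE (G : 'cV[R]_d -> \bar R) k : measurable_fun [set: 'cV[R]_d] G ->
    (forall x, 0 <= G x) ->
  \int[P]_(w in S @^-1` [set k]) G (X w) =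
  \int[lebesgue_cV R d]_x (G x * (q k * mvnormal_pdf (mu k) Sigma x)%:E).
  move=> mG G0; apply: ge0_integral_law_density => //.
  - exact: measurable_event.
  - by apply: measurable_funM => //; exact: measurable_mvnormal_pdf.
  - by move=> x; rewrite mulr_ge0 ?mvnormal_pdf_ge0 ?ltW.
  - move=> A mA; have := Xnormal k A mA; rewrite /cond_law PS => XA.
    under eq_integral do rewrite EFinM.
    rewrite ge0_integralZl//; last 3 first.
    + apply/measurable_EFinP/measurable_funTS; exact: measurable_mvnormal_pdf.
    + by move=> x _; rewrite lee_fin mvnormal_pdf_ge0.
    + by rewrite lee_fin ltW.
    by rewrite -XA inver gt_eqF// muleCA -EFinM divff ?mule1// gt_eqF.
(* The prior log odds, plus the constant part of the exponent in [mvnormal_pdf_shift] at mean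
   [mu false]. *)
pose kappa := (ln (q true / q false) - dot c (mu false) -
  dot c (Sigma *m c) / 2)%R.
exists c, kappa => F mF F0.
have mtilt : measurable_fun [set: 'cV[R]_d] (fun x =>
    F (x + (sigma ^+ 2)%R *: c)%R * (expR (dot c x + kappa))%:E).
  apply: emeasurable_funM.
    by apply: measurableT_comp => //; apply: measurable_cVD.
  apply/measurable_EFinP/measurableT_comp => //.
  by apply: measurable_funD => //; exact: measurable_dot.
rewrite XE// (XE _ false mtilt); last first.
  by move=> x; rewrite mule_ge0// lee_fin expR_ge0.
(* Moving the integration variable by sigma^2 c leaves the density of class 1 centred at mu_0 +
   Sigma c, which is the density of class 0 shifted by Sigma c. *)
rewrite -[LHS](ge0_integral_translate_cV _ ((sigma ^+ 2) *: c)%R); last 2 first.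
- apply: emeasurable_funM => //; apply/measurable_EFinP/measurable_funM => //.
  exact: measurable_mvnormal_pdf.
- by move=> x; rewrite mule_ge0// lee_fin mulr_ge0 ?mvnormal_pdf_ge0 ?ltW.
apply: eq_integral => x _; rewrite -muleA -EFinM; congr (_ * _%:E).
have -> : mvnormal_pdf (mu true) Sigma (x + (sigma ^+ 2) *: c)%R =
          mvnormal_pdf (mu false) Sigma (x - Sigma *m c)%R.
  have -> : mu true = (Sigma *m c + (sigma ^+ 2) *: c + mu false)%R.
    by rewrite cE subrK.
  rewrite /mvnormal_pdf; set u := (Sigma *m c)%R; set v := (_ *: c)%R.
  rewrite (_ : x + v - (u + v + mu false) = x - u - mu false)%R//.
  by rewrite !opprD !addrA (addrAC x v) addrK.
rewrite mvnormal_pdf_shift//.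
have -> : expR (dot c x + kappa)%R = (q true / q false *
    expR (dot c (x - mu false) - dot c (Sigma *m c) / 2))%R.
  rewrite -[X in (X * _)%R](lnK (_ : _ \is Num.pos)) ?posrE ?divr_gt0//.
  by rewrite -expRD dotDr mulmxN [X in (_ + X - _)%R]mxE /kappa; congr expR; ring.
by field; rewrite gt_eqF.
Qed.

End class_conditional_tilt.

(** * Elementary properties of the sigmoid *)

Lemma sigmoidE {R : realType} (z : R) :
  sigmoid z * (expR z + 1) = expR z.
Proof.
have ez := expR_gt0 z.
rewrite /sigmoid expRN; field.
by rewrite !gt_eqF ?addr_gt0.
Qed.

Lemma sigmoid_ge0 {R : realType} (z : R) : 0 <= sigmoid z.
Proof. by rewrite divr_ge0 ?addr_ge0 ?expR_ge0. Qed.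

Lemma sigmoid_le1 {R : realType} (z : R) : sigmoid z <= 1.
Proof.
by rewrite /sigmoid ler_pdivrMr ?mul1r ?lerDl ?expR_ge0// ltr_pwDl ?expR_ge0.
Qed.

Lemma measurable_sigmoid {R : realType} : measurable_fun [set: R] (@sigmoid R).
Proof.
apply: nondecreasing_measurable => // x y xy.
rewrite /sigmoid !div1r lef_pV2 ?posrE ?addr_gt0 ?expR_gt0//.
by rewrite lerD2l ler_expR lerN2.
Qed.

(** * Regression function and squared risk when the log odds are known *)

Section log_odds_regression.
Local Open Scope ereal_scope.
Context {R : realType} {disp d1 : measure_display}
  {Omega : measurableType disp} {T : measurableType d1}
  {P : probability Omega R}.
Variables (S : {RV P >-> bool}) (X : {RV P >-> T}) (L : T -> R).
Hypothesis mL : measurable_fun [set: T] L.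
(** [L] plays the part of the log odds of S given X; the two class laws are unnormalised, so [L]
    includes the prior log odds. *)
Hypothesis log_odds : forall F : T -> \bar R, measurable_fun [set: T] F ->
  (forall x, 0 <= F x) ->
  \int[P]_(w in S @^-1` [set true]) F (X w) =
  \int[P]_(w in S @^-1` [set false]) (F (X w) * (expR (L (X w)))%:E).

Let Snum (w : Omega) : R := (S w)%:R.
Let h0 (x : T) := sigmoid (L x).

Let mh0 : measurable_fun [set: T] h0.
Proof. exact: measurableT_comp measurable_sigmoid mL. Qed.

Let mexpL D : measurable_fun D (fun w => (expR (L (X w)))%:E).
Proof.
apply: measurable_funTS; apply/measurable_EFinP; apply: measurableT_comp => //.
exact: measurableT_comp.
Qed.

Let mcomp (g : T -> R) D :
  measurable_fun [set: T] g -> measurable_fun D (fun w => g (X w)).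
Proof. by move=> mg; apply: measurable_funTS; exact: measurableT_comp. Qed.

(** Split according to [S] and carry the part S = 1 over to S = 0. Identities between expectations
    thereby reduce to pointwise identities under one integral. *)
Lemma integral_log_odds (u : bool -> T -> \bar R) :
  (forall k, measurable_fun [set: T] (u k)) -> (forall k x, 0 <= u k x) ->
  \int[P]_w u (S w) (X w) =
  \int[P]_(w in S @^-1` [set false])
    (u true (X w) * (expR (L (X w)))%:E + u false (X w)).
Proof.
move=> mu u0; have mevent := measurable_event S.
have SE : [set: Omega] = S @^-1` [set true] `|` S @^-1` [set false].
  by apply/seteqP; split=> // w _ /=; case: (S w); [left|right].
have muX k D : measurable_fun D (fun w => u k (X w)).
  by apply: measurable_funTS; exact: measurableT_comp.
have uS k : \int[P]_(w in S @^-1` [set k]) u (S w) (X w) =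
    \int[P]_(w in S @^-1` [set k]) u k (X w).
  by apply: eq_integral => w; rewrite inE/= => ->.
rewrite ge0_integralD//; last 2 first.
- by move=> w _; rewrite mule_ge0// lee_fin expR_ge0.
- exact: emeasurable_funM.
rewrite -log_odds// -!uS SE ge0_integral_setU//.
- rewrite -SE.
  rewrite (_ : (fun w => u (S w) (X w)) =
    fun w => if S w then u true (X w) else u false (X w)); last first.
    by apply/funext => w; case: (S w).
  by apply: measurable_fun_ifT.
- rewrite disj_set2E; apply/eqP/seteqP; split=> // w /= [-> //].
Qed.

(** Pythagoras for the regression function. With E = exp(L) and h = sigmoid(L), the two integrands
    over S = 0 differ by 2 (g - h) (h (E + 1) - E), which is 0 by [sigmoidE]. *)
Lemma sq_risk_decomposition (g : T -> R) : measurable_fun [set: T] g ->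
  sq_risk P Snum X g = sq_risk P Snum X h0 + approximation_error P X g h0.
Proof.
move=> mg; have mevent := measurable_event S.
have ge0 (x y z : R) : (0 <= x ^+ 2 * expR y + z ^+ 2)%R.
  by apply: addr_ge0; [apply: mulr_ge0; [exact: sqr_ge0|exact: expR_ge0]|
                       exact: sqr_ge0].
have riskE (h : T -> R) : measurable_fun [set: T] h -> sq_risk P Snum X h =
    \int[P]_(w in S @^-1` [set false])
      ((1 - h (X w)) ^+ 2 * expR (L (X w)) + h (X w) ^+ 2)%:E.
  move=> mh; rewrite /sq_risk unlock.
  rewrite (integral_log_odds (fun k x => ((k%:R - h x) ^+ 2)%:E)).
  - by apply: eq_integral => w _; rewrite sub0r sqrrN -EFinM -EFinD.
  - move=> k; apply/measurable_EFinP; apply: measurable_funX.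
    exact: measurable_funB.
  - by move=> k x; rewrite lee_fin sqr_ge0.
rewrite !riskE// /approximation_error unlock.
rewrite (integral_log_odds (fun _ x => ((g x - h0 x) ^+ 2)%:E)); last 2 first.
- move=> k; apply/measurable_EFinP; apply: measurable_funX.
  exact: measurable_funB.
- by move=> k x; rewrite lee_fin sqr_ge0.
rewrite -ge0_integralD//.
- apply: eq_integral => w _; rewrite -EFinM -!EFinD; congr _%:E.
  have := sigmoidE (L (X w)); rewrite -/(h0 _); move: (expR _) (h0 _) => E h hE.
  apply/subr0_eq; rewrite (_ : _ - _ = 2 * (g (X w) - h) * (h * (E + 1) - E))%R.
    by rewrite hE subrr mulr0.
  by ring.
- by move=> w _; rewrite lee_fin.
- apply/measurable_EFinP; apply: measurable_funD.
    apply: measurable_funM; last exact/measurable_EFinP.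
    by apply: measurable_funX; apply: measurable_funB => //; exact: mcomp.
  by apply: measurable_funX; exact: mcomp.
- by move=> w _; rewrite -EFinM -EFinD lee_fin.
- have mgh : measurable_fun (S @^-1` [set false])
      (fun w => ((g (X w) - h0 (X w)) ^+ 2)%:E).
    apply/measurable_EFinP/measurable_funX.
    by apply: measurable_funB; exact: mcomp.
  by apply: emeasurable_funD => //; exact: emeasurable_funM.
Qed.

Lemma approximation_error_ge0 (g h : T -> R) : 0 <= approximation_error P X g h.
Proof.
rewrite /approximation_error unlock.
by apply: integral_ge0 => w _; rewrite lee_fin sqr_ge0.
Qed.

(** Both [Snum] and [h0] take values in [0, 1], so the integrand is at most 1. Finiteness allows
    this risk to be cancelled in an inequality of extended reals. *)
Lemma sq_risk_sigmoid_fin_num : sq_risk P Snum X h0 \is a fin_num.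
Proof.
rewrite /sq_risk unlock ge0_fin_numE; last first.
  by apply: integral_ge0 => w _; rewrite lee_fin sqr_ge0.
apply: (@le_lt_trans _ _ (\int[P]_w cst 1 w)); last first.
  rewrite integral_cst// mul1e.
  by apply: le_lt_trans (probability_le1 P measurableT) _; rewrite ltry.
have mS : measurable_fun [set: Omega] Snum.
  exact: (@measurableT_comp _ _ _ _ _ _ (fun b : bool => b%:R : R)).
apply: ge0_le_integral => //.
- by move=> w _; rewrite lee_fin sqr_ge0.
- apply/measurable_EFinP/measurable_funX; apply: measurable_funB => //.
  exact: mcomp.
- move=> w _; rewrite lee_fin -sqrrN opprB.
  rewrite -[X in (_ <= X)%R](expr1n _ 2) -real_normK ?num_real//.
  rewrite lerXn2r ?nnegrE//.
  have := sigmoid_ge0 (L (X w)); have := sigmoid_le1 (L (X w)).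
  by rewrite -/(h0 _) /Snum ler_norml; case: (S w) => /= h1 h2; lra.
Qed.

Lemma risk_minimizer_sigmoid (H : set (T -> R)) :
  (forall g, H g -> measurable_fun [set: T] g) -> H h0 ->
  is_risk_minimizer P H Snum X h0.
Proof.
move=> mH Hh0; split=> // g Hg; rewrite (sq_risk_decomposition _ (mH _ Hg)).
by rewrite leeDl// approximation_error_ge0.
Qed.

(** Comparing [h] with the competitor [h0] and cancelling the finite risk of [h0] in the
    decomposition leaves a nonnegative error that is at most 0. *)
Lemma risk_minimizer_error (H : set (T -> R)) (h : T -> R) :
  (forall g, H g -> measurable_fun [set: T] g) -> H h0 ->
  is_risk_minimizer P H Snum X h -> approximation_error P X h h0 = 0.
Proof.
move=> mH Hh0 [Hh /(_ _ Hh0)]; rewrite (sq_risk_decomposition _ (mH _ Hh)).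
rewrite -[X in _ <= X]adde0 leeD2lE ?sq_risk_sigmoid_fin_num// => le0.
by apply/eqP; rewrite eq_le le0 approximation_error_ge0.
Qed.

(** Integrable functions with equal integrals over every measurable [B] agree almost everywhere.
    Carried over to S = 0, the equality of integrals is h0 E + h0 = E for E = exp(L). *)
Lemma regression_sigmoid (eta : T -> R) : is_regression P Snum X eta ->
  ae_eq (distribution P X) setT (EFin \o h0) (EFin \o eta).
Proof.
move=> [meta ieta etaE].
apply: integral_ae_eq => //.
- apply: measurable_bounded_integrable => //.
    apply: le_lt_trans (probability_le1 (distribution P X) measurableT) _.
    by rewrite ltry.
  exists 1%R; split => // y y1 x _ /=.
  by rewrite ger0_norm ?sigmoid_ge0// (le_trans (sigmoid_le1 _))// ltW.
- exact/measurable_EFinP.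
move=> B _ mB.
have mXB : measurable (X @^-1` B).
  by rewrite -[X in measurable X]setTI; exact: measurable_funP.
have -> : \int[distribution P X]_(x in B) (eta x)%:E =
    \int[P]_(w in X @^-1` B) (eta (X w))%:E.
  apply: integral_pushforward => //; first exact/measurable_EFinP.
  exact: integrableS ieta.
rewrite [RHS]etaE// ge0_integral_pushforward//; last 2 first.
- exact/measurable_funTS/measurable_EFinP.
- by move=> x _; rewrite lee_fin sigmoid_ge0.
(* The indicator of [B] is absorbed into the integrand, which then has the form required by
   [integral_log_odds]. *)
rewrite integral_mkcond [RHS]integral_mkcond.
have mB1 : measurable_fun [set: T] (\1_B : T -> R) by exact: measurable_indic.
transitivity (\int[P]_w (h0 (X w) * \1_B (X w))%:E).
  apply: eq_integral => w _; rewrite patchE indicE.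
  rewrite (_ : (w \in _) = (X w \in B)); last by apply/idP/idP; rewrite !inE.
  by case: ifPn; rewrite (mulr1, mulr0).
transitivity (\int[P]_w ((S w)%:R * \1_B (X w))%:E); last first.
  apply: eq_integral => w _; rewrite patchE indicE.
  rewrite (_ : (w \in _) = (X w \in B)); last by apply/idP/idP; rewrite !inE.
  by case: ifPn; rewrite (mulr1, mulr0).
rewrite (integral_log_odds (fun _ x => (h0 x * \1_B x)%:E)); last 2 first.
- by move=> k; apply/measurable_EFinP; exact: measurable_funM.
- by move=> k x; rewrite lee_fin mulr_ge0 ?sigmoid_ge0.
rewrite (integral_log_odds (fun k x => (k%:R * \1_B x)%:E)); last 2 first.
- by move=> k; apply/measurable_EFinP; exact: measurable_funM.
- by move=> k x; rewrite lee_fin mulr_ge0.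
apply: eq_integral => w _; rewrite -!EFinM -!EFinD; congr _%:E.
rewrite mul1r mul0r addr0 mulrAC -mulrDl.
rewrite [RHS]mulrC -[in RHS]sigmoidE -/(h0 _); congr (_ * _)%R.
by rewrite mulrDr mulr1.
Qed.

(** The error depends on [eta] only up to null sets of the law of [X], so [eta] may be replaced by
    [h0]; the square is symmetric. *)
Lemma approximation_error_regression (eta h : T -> R) :
  measurable_fun [set: T] h -> is_regression P Snum X eta ->
  approximation_error P X eta h = approximation_error P X h h0.
Proof.
move=> mh reta; have [meta _ _] := reta.
have lawE (g : T -> R) : measurable_fun [set: T] g ->
    approximation_error P X g h =
    \int[distribution P X]_x ((g x - h x) ^+ 2)%:E.
  move=> mg; rewrite /approximation_error unlock ge0_integral_distribution//.
  - apply/measurable_EFinP/measurable_funX; exact: measurable_funB.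
  - by move=> x; rewrite lee_fin sqr_ge0.
transitivity (approximation_error P X h0 h).
  rewrite !lawE//; apply: ae_eq_integral => //.
  - apply/measurable_EFinP/measurable_funX; exact: measurable_funB.
  - apply/measurable_EFinP/measurable_funX; exact: measurable_funB.
  - by apply: filterS (regression_sigmoid _ reta) => x /= /(_ I)[->].
rewrite /approximation_error unlock; apply: eq_integral => w _.
by rewrite -sqrrN opprB.
Qed.

End log_odds_regression.

(** * The logistic class and the vanishing of the approximation error *)

Lemma measurable_logistic_class (R : realType) (d : nat) (g : 'cV[R]_d -> R) :
  logistic_class R d g -> measurable_fun [set: 'cV[R]_d] g.
Proof.
move=> [a [b ->]]; apply: measurableT_comp measurable_sigmoid _.
by apply: measurable_funD => //; exact: measurable_dot.
Qed.

Theorem proposition4 (R : realType) (d : nat) (d_gt0 : (1 <= d)%N)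
    (p : R) (p_gt0 : 0 < p) (p_lt1 : p < 1)
    (disp : measure_display) (Omega : measurableType disp)
    (P : probability Omega R)
    (S : {RV P >-> bool}) (X Z : {RV P >-> 'cV[R]_d})
    (S_ber : distribution P S = bernoulli_prob p :> (set bool -> \bar R))
    (sigma : R) (sigma_gt0 : 0 < sigma)
    (Z_normal : is_mvnormal (distribution P Z) 0 1%:M)
    (Z_indep : independent_rv P Z (fun w => (X w, S w)))
    (hyp :
      (exists a b : 'cV[R]_d, {ae P, forall w, X w = (S w)%:R *: a + b}) \/
      (exists (mu : bool -> 'cV[R]_d) (Sigma : 'M[R]_d),
         posdefmx Sigma /\
         forall k : bool,
           is_mvnormal (cond_law P X (S @^-1` [set k])) (mu k) Sigma)) :
  let Xsigma := fun w => X w + sigma *: Z w in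
  let Snum := fun w => (S w)%:R : R in
  (exists h, is_risk_minimizer P (logistic_class R d) Snum Xsigma h) /\
  (forall eta h,
     is_regression P Snum Xsigma eta ->
     is_risk_minimizer P (logistic_class R d) Snum Xsigma h ->
     approximation_error P Xsigma eta h = 0%E).
Proof.
move=> Xsigma Snum.
pose q k := bernoulli_pmf p k.
have q_gt0 k : 0 < q k by rewrite /q /bernoulli_pmf; case: k; rewrite ?subr_gt0.
have PS k : P (S @^-1` [set k]) = (q k)%:E.
  rewrite -[LHS]/(distribution P S [set k]) S_ber bernoulli_prob1//.
  by rewrite !ltW.
have [c [kappa XQ]] : exists (c : 'cV[R]_d) (kappa : R),
    forall F : 'cV[R]_d -> \bar R, measurable_fun [set: 'cV[R]_d] F ->
    (forall x, (0 <= F x)%E) ->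
    (\int[P]_(w in S @^-1` [set true]) F (X w) =
     \int[P]_(w in S @^-1` [set false])
       (F (X w + (sigma ^+ 2)%R *: c)%R * (expR (dot c (X w) + kappa))%:E))%E.
  case: hyp => [[a [b Xab]]|[mu [Sigma [Spos Xnormal]]]].
    exact: (point_mass_tilt _ _ _ _ q_gt0 PS sigma_gt0 _ _ Xab).
  exact: (gaussian_classes_tilt S X q sigma q_gt0 PS mu Sigma Spos Xnormal).
have mXsigma : measurable_fun [set: Omega] Xsigma.
  by apply: measurable_cVD => //; exact: measurable_cVZ.
pose Xs : {RV P >-> 'cV[R]_d} :=
  HB.pack Xsigma (isMeasurableFun.Build _ _ _ _ _ mXsigma).
(* By [noise_tilt], the noise keeps the slope [c] and only lowers the constant, so the log odds
   given [Xsigma] are affine. *)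
pose b := kappa - sigma ^+ 2 * dot c c / 2.
pose L (x : 'cV[R]_d) : R := dot c x + b.
have mL : measurable_fun [set: 'cV[R]_d] L.
  by apply: measurable_funD => //; exact: measurable_dot.
have log_odds := noise_tilt _ _ _ _ Z_normal Z_indep _ _ XQ.
have Hh0 : logistic_class R d (fun x => sigmoid (L x)) by exists c, b.
split.
  exists (fun x => sigmoid (L x)).
  exact: (risk_minimizer_sigmoid S Xs L mL log_odds _
    (@measurable_logistic_class R d) Hh0).
move=> eta h reta hmin.
rewrite (approximation_error_regression S Xs L mL log_odds)//; last first.
  by apply: measurable_logistic_class; case: hmin.
exact: (risk_minimizer_error S Xs L mL log_odds _ _
  (@measurable_logistic_class R d) Hh0).
Qed.
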